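(* Let $q$ be a prime power, $e\ge1$, $Q=q^e$, and $n\ge0$ an integer. The polynomial $g_{n,q}(X,Y)$ is a permutation polynomial in two variables over $\mathbb{F}_Q$ if and only if $g_{n,q}(X)$ is a permutation polynomial over $\mathbb{F}_Q$.
   Context: For a prime power $q$ (a power of the prime $p$) and an integer $n\ge 0$, $g_{n,q}(X)\in\mathbb{F}_p[X]$ denotes the unique polynomial satisfying $\sum_{a\in\mathbb{F}_q}(X+a)^n=g_{n,q}(X^q-X)$, and the bivariate polynomial is $g_{n,q}(X,Y)=g_{n,q}(X+Y)$, i.e. the univariate polynomial evaluated at $X+Y$. A univariate polynomial over $\mathbb{F}_Q$ is a permutation polynomial over $\mathbb{F}_Q$ if it induces a bijection of $\mathbb{F}_Q$. A polynomial $f\in\mathbb{F}_Q[X,Y]$ is a permutation polynomial in two variables over $\mathbb{F}_Q$ if for each $\alpha\in\mathbb{F}_Q$ the equation $f(X,Y)=\alpha$ has exactly $Q$ solutions in $\mathbb{F}_Q^2$. *)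

(* Defs.v *)
From HB Require Import structures.
From mathcomp Require Import all_boot all_algebra all_field.

Set Implicit Arguments.
Unset Strict Implicit.
Unset Printing Implicit Defensive.

Import GRing.Theory.
Local Open Scope ring_scope.

(* The prime-field map 'F_p -> R, meaningful when R has characteristic p: it   *)
(* is then a ring morphism (Fp_emb_zmod and Fp_emb_monoid below), and the only *)
(* one.                                                                        *)
Definition Fp_emb (p : nat) (R : nzRingType) (c : 'F_p) : R := (c : nat)%:R.
Arguments Fp_emb {p} R c.

(* \sum_(a in F_q) (X + a)^n = g (X^q - X) in F_q[X], where q = #|Fq|. *)
Definition g_spec (p : nat) (Fq : finFieldType) (n : nat) (g : {poly 'F_p}) :
    bool :=
  \sum_(a : Fq) ('X + a%:P) ^+ n == map_poly (Fp_emb Fq) g \Po ('X^#|Fq| - 'X).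

Section FpEmb.
Variables (p : nat) (R : nzRingType) (pcharRp : p \in [pchar R]).

Fact Fp_emb_inZp m : Fp_emb R (inZp m : 'F_p) = m%:R.
Proof.
by rewrite /Fp_emb /= (Fp_cast (pcharf_prime pcharRp)) (GRing.natr_mod_pchar pcharRp).
Qed.

Lemma Fp_emb_monoid : monoid_morphism (@Fp_emb p R).
Proof.
split=> [|x y]; first exact: (Fp_emb_inZp 1).
by rewrite [LHS](Fp_emb_inZp (x * y)) natrM.
Qed.

Lemma Fp_emb_zmod : zmod_morphism (@Fp_emb p R).
Proof.
have embD x y : Fp_emb R (x + y : 'F_p) = Fp_emb R x + Fp_emb R y.
  by rewrite [LHS](Fp_emb_inZp (x + y)) natrD.
by move=> x y; apply/eqP; rewrite eq_sym subr_eq -embD subrK.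
Qed.

End FpEmb.

Definition Fp_rmorph (p : nat) (R : nzRingType) of p \in [pchar R] :
  'F_p -> R := Fp_emb R.

HB.instance Definition _ p (R : nzRingType) (pcharRp : p \in [pchar R]) :=
  GRing.isZmodMorphism.Build 'F_p R (Fp_rmorph pcharRp) (Fp_emb_zmod pcharRp).
HB.instance Definition _ p (R : nzRingType) (pcharRp : p \in [pchar R]) :=
  GRing.isMonoidMorphism.Build 'F_p R (Fp_rmorph pcharRp)
    (Fp_emb_monoid pcharRp).

Section G.
Variables (p : nat) (Fq : finFieldType) (charFq : p \in [pchar Fq]).
Local Notation q := #|Fq|.
Local Notation f := (Fp_rmorph charFq).

Let size_XqX : size ('X^q - 'X : {poly Fq}) = q.+1.
Proof. by rewrite size_polyDl size_polyXn // size_polyN size_polyX ltnS finNzRing_gt1. Qed.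

Fact g_unique n (g h : {poly 'F_p}) : g_spec Fq n g -> g_spec Fq n h -> g = h.
Proof.
rewrite /g_spec => /eqP-> /eqP; rewrite -/(Fp_rmorph charFq) => /eqP.
rewrite -subr_eq0 -comp_polyB comp_poly_eq0 ?size_XqX ?ltnS; last first.
  exact: ltnW (finNzRing_gt1 _).
by rewrite subr_eq0 => /eqP /(map_poly_inj f).
Qed.

Let Fp_emb_fixed (s : Fq) : s ^+ p = s -> {c : 'F_p | Fp_emb Fq c = s}.
Proof.
move=> sp; have p_pr := pcharf_prime charFq.
suff /codomP/sig_eqW[c ->]: s \in codom f by exists c.
apply/negP => /negP sNf.
have XpX : size ('X^p - 'X : {poly Fq}) = p.+1.
  by rewrite size_polyDl size_polyXn // size_polyN size_polyX ltnS prime_gt1.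
have P0 : 'X^p - 'X != 0 :> {poly Fq} by rewrite -size_poly_eq0 XpX.
have := @max_poly_roots Fq _ (s :: codom f) P0.
rewrite XpX /= size_codom card_Fp // ltnn => /(_ _ _)/negP; case=> //.
  rewrite rootE !hornerE sp subrr eqxx /=; apply/allP=> _ /codomP[c ->].
  have cp : c ^+ p = c by rewrite -[RHS]expf_card card_Fp.
  by rewrite rootE !hornerE -rmorphXn /= cp subrr.
by rewrite sNf /= map_inj_uniq ?enum_uniq //; apply: fmorph_inj.
Qed.

Fact g_exists n : exists g : {poly 'F_p}, g_spec Fq n g.
Proof.
have q_gt1 : (1 < q)%N := finNzRing_gt1 Fq.
elim/ltn_ind: n => n IHn; have [lt_nq | le_qn] := ltnP n q.
  pose s : Fq := \sum_a a ^+ n.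
  have [|c fc] := @Fp_emb_fixed s.
    rewrite -(pFrobenius_autE charFq) rmorph_sum /=.
    rewrite [RHS](reindex_inj (fmorph_inj (pFrobenius_aut charFq))).
    by apply: eq_bigr => a _; rewrite rmorphXn.
  exists c%:P; rewrite /g_spec -/f map_polyC /= comp_polyC {1}/Fp_rmorph fc -subr_eq0.
  set S := \sum__ _; apply/negPn/negP => S0.
  have := @max_poly_roots Fq _ (enum Fq) S0; rewrite enum_uniq -cardE => H.
  suff szS : (size (S - s%:P)%R <= q)%N.
    have := leq_trans (H _ isT) szS; rewrite ltnn => /(_ _)/negP; case=> //.
    apply/allP => b _; rewrite rootE !hornerE horner_sum subr_eq0.
    rewrite [X in _ == X](reindex_inj (addrI b)); apply/eqP.
    by apply: eq_bigr => a _; rewrite !hornerE.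
  rewrite (leq_trans (size_polyD _ _)) // geq_max size_polyN.
  rewrite (leq_trans (size_polyC_leq1 _)) ?(ltnW q_gt1) // andbT.
  apply: (leq_trans (size_sum _ _ _)); apply/bigmax_leqP => a _.
  apply: (leq_trans (size_poly_exp_leq _ _)).
  by rewrite size_XaddC mul1n.
have [m def_n] : exists m, n = (m + q)%N by exists (n - q)%N; rewrite subnK.
have [|g1 /eqP Hg1] := IHn m.+1; first by rewrite def_n -addn1 ltn_add2l.
have [|g0 /eqP Hg0] := IHn m.
  by rewrite def_n -[X in (X < _)%N]addn0 ltn_add2l ltnW.
exists (g1 + 'X * g0); rewrite /g_spec -/f rmorphD rmorphM /= map_polyX.
rewrite comp_polyD comp_polyM comp_polyX -Hg1 -Hg0 mulr_sumr -big_split /=.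
apply/eqP/eq_bigr => a _; rewrite def_n exprD exprS -mulrDl mulrC; congr (_ * _).
have charP : p \in [pchar {poly Fq}] by rewrite pchar_poly.
have [k qk] : exists k, q = (p ^ k)%N.
  by exists (logn p q); apply: (card_pprimeChar charFq).
have pnat_q : [pchar {poly Fq}].-nat q.
  by rewrite (eq_pnat _ (pcharf_eq charP)) qk pnatX pnat_id ?(pcharf_prime charFq).
by rewrite exprDn_pchar // -polyC_exp expf_card [RHS]addrC addrA subrK.
Qed.

End G.

(* The polynomial g_{n,q} over the prime field; see gpolyP, and g_unique for  *)
(* its uniqueness.                                                            *)
Definition gpoly (p : nat) (Fq : finFieldType) (charFq : p \in [pchar Fq])
    (n : nat) : {poly 'F_p} :=
  xchoose (g_exists charFq n).

Lemma gpolyP (p : nat) (Fq : finFieldType) (charFq : p \in [pchar Fq]) n :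
  g_spec Fq n (gpoly charFq n).
Proof. exact: xchooseP. Qed.

Definition gpoly2 (p : nat) (Fq : finFieldType) (charFq : p \in [pchar Fq])
    (n : nat) : {poly {poly 'F_p}} :=
  poly_XaY (gpoly charFq n).

Definition perm_poly (F : finFieldType) (f : {poly F}) : Prop :=
  bijective (fun x : F => f.[x]).

Definition perm_poly2 (F : finFieldType) (f : {poly {poly F}}) : Prop :=
  forall alpha : F, #|[set u : F * F | f.[u.1, u.2] == alpha]| = #|F|.

(* Main.v *)
Require Import Defs.
From mathcomp Require Import all_boot all_algebra all_field.

Set Implicit Arguments.
Unset Strict Implicit.
Unset Printing Implicit Defensive.

Import GRing.Theory.
Local Open Scope ring_scope.

(** Addition F x F -> F has all its fibres of size |F|, so f(x + y) = a has |F| times as many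
    solutions as f(x) = a. The former count is |F| for every a exactly when the latter is 1 for
    every a, that is, when f is bijective. This works for every polynomial f over a finite field
    ([perm_poly2_XaY]); [map_poly_XaY] brings the polynomial g, defined over the prime field, into
    that form. *)

Lemma map_poly_XaY (R S : nzRingType) (f : {rmorphism R -> S}) (g : {poly R}) :
  map_poly (map_poly f) (poly_XaY g) = poly_XaY (map_poly f g).
Proof.
rewrite /poly_XaY map_comp_poly rmorphD /= map_polyX map_polyC /= map_polyX.
by rewrite -!map_poly_comp; congr (_ \Po _); apply: eq_map_poly => c /=;
  rewrite map_polyC.
Qed.

(** The shear (x, y) -> (x, x + y) permutes V x V, and the set counted is its preimage of V x A. *)
Lemma card_preim_add (V : finZmodType) (A : {set V}) :
  #|[set u : V * V | u.1 + u.2 \in A]| = (#|V| * #|A|)%N.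
Proof.
pose shear (u : V * V) := (u.1, u.1 + u.2).
have shear_inj : injective shear.
  by move=> [x y] [x' y'] [<- /addrI <-].
rewrite -cardsT -cardsX -[RHS](card_preimset _ shear_inj).
by apply: eq_card => u; rewrite !inE.
Qed.

Lemma bijective_card_fiber (T : finType) (f : T -> T) :
  bijective f <-> forall y, #|[set x | f x == y]| = 1%N.
Proof.
split=> [[h fK hK] y | f1].
  apply/eqP/cards1P; exists (h y); apply/setP => x.
  by rewrite !inE (can2_eq fK hK).
apply: injF_bij => x1 x2 fx; have /eqP/cards1P[z fz] := f1 (f x1).
have /set1P-> : x1 \in [set z] by rewrite -fz inE.
by apply/esym/set1P; rewrite -fz inE fx.
Qed.

Lemma perm_poly2_XaY (F : finFieldType) (f : {poly F}) :
  perm_poly2 (poly_XaY f) <-> perm_poly f.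
Proof.
have F_gt0 : (0 < #|F|)%N := ltnW (finNzRing_gt1 F).
have fiber2 a : #|[set u : F * F | (poly_XaY f).[u.1, u.2] == a]|
    = (#|F| * #|[set x | f.[x] == a]|)%N.
  rewrite -card_preim_add; apply: eq_card => u; rewrite !inE.
  by rewrite horner_poly_XaY horner_comp !hornerE.
apply: iff_trans (iff_sym (bijective_card_fiber _)).
split=> f1 a; have := f1 a; rewrite ?fiber2 => fa.
  by apply/eqP; rewrite -(eqn_pmul2l F_gt0) fa muln1.
by rewrite fa muln1.
Qed.

Theorem proposition5p6 (p k e n : nat) (Fq FQ : finFieldType)
    (p_prime : prime p) (k_gt0 : (0 < k)%N) (cardFq : #|Fq| = (p ^ k)%N)
    (e_gt0 : (0 < e)%N) (cardFQ : #|FQ| = ((p ^ k) ^ e)%N) :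
  let charFq := card_finPcharP cardFq p_prime in
  perm_poly2 (map_poly (map_poly (Fp_emb FQ)) (gpoly2 charFq n)) <->
  perm_poly (map_poly (Fp_emb FQ) (gpoly charFq n)).
Proof.
move=> charFq; rewrite -expnM in cardFQ.
have charFQ := card_finPcharP cardFQ p_prime.
(* [Fp_rmorph charFQ] is the same function, but carries the ring morphism structure that
   [map_poly_XaY] needs. *)
rewrite -[Fp_emb FQ]/(Fp_rmorph charFQ : 'F_p -> FQ) /gpoly2 map_poly_XaY.
exact: perm_poly2_XaY.
Qed.
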